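(* Let $\mathbb K$ be a field of characteristic $0$ and let $(A,*,\alpha)$ be a multiplicative Hom-Malcev algebra over $\mathbb K$. Define a ternary operation on $A$ by $$\{x,y,z\} := (x*y)*\alpha(z) - (y*z)*\alpha(x) - (z*x)*\alpha(y)$$ for all $x,y,z\in A$. Then $A$ has a Hom-Lie-Yamaguti structure with these operations, i.e. $(A,*,\{\,,\,,\,\},\alpha)$ is a Hom-Lie-Yamaguti algebra.
   Context: All vector spaces and algebras are over a field $\mathbb K$ of characteristic $0$. The notation $\circlearrowleft_{(x,y,z)}$ means the sum over cyclic permutations of $x,y,z$. A Hom-algebra $(A,*,\alpha)$ is a $\mathbb K$-vector space $A$ with a bilinear operation $*:A\times A\to A$ and a linear map $\alpha:A\to A$. It is multiplicative if $\alpha(x*y)=\alpha(x)*\alpha(y)$ for all $x,y\in A$. The Hom-Jacobian is $J_\alpha(x,y,z)=\circlearrowleft_{(x,y,z)}(x*y)*\alpha(z)$. A Hom-Malcev algebra is a Hom-algebra $(A,*,\alpha)$ such that $*$ is anticommutative ($x*y=-y*x$) and the Hom-Malcev identity $$J_\alpha(\alpha(x),\alpha(y),x*z)=J_\alpha(x,y,z)*\alpha^2(x)$$ holds for all $x,y,z\in A$. A Hom-Lie-Yamaguti algebra (Hom-LYA) is a quadruple $(A,*,\{\,,\,,\,\},\alpha)$ in which $A$ is a $\mathbb K$-vector space, $*$ is a binary (bilinear) operation and $\{\,,\,,\,\}$ a ternary (trilinear) operation on $A$, and $\alpha:A\to A$ is a linear map, such that for all $u,v,w,x,y,z\in A$: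 (HLY1) $\alpha(x*y)=\alpha(x)*\alpha(y)$; (HLY2) $\alpha(\{x,y,z\})=\{\alpha(x),\alpha(y),\alpha(z)\}$; (HLY3) $x*y=-y*x$; (HLY4) $\{x,y,z\}=-\{y,x,z\}$; (HLY5) $\circlearrowleft_{(x,y,z)}[(x*y)*\alpha(z)+\{x,y,z\}]=0$; (HLY6) $\circlearrowleft_{(x,y,z)}\{x*y,\alpha(z),\alpha(u)\}=0$; (HLY7) $\{\alpha(x),\alpha(y),u*v\}=\{x,y,u\}*\alpha^2(v)+\alpha^2(u)*\{x,y,v\}$; (HLY8) $\{\alpha^2(x),\alpha^2(y),\{u,v,w\}\}=\{\{x,y,u\},\alpha^2(v),\alpha^2(w)\}+\{\alpha^2(u),\{x,y,v\},\alpha^2(w)\}+\{\alpha^2(u),\alpha^2(v),\{x,y,w\}\}$. *)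

(* Defs.v *)
From HB Require Import structures.
From mathcomp Require Import all_boot all_algebra.

Set Implicit Arguments.
Unset Strict Implicit.
Unset Printing Implicit Defensive.

Import GRing.Theory.
Local Open Scope ring_scope.

Section HomAlgebras.

Variables (K : fieldType) (A : lmodType K).
Implicit Types (mul : A -> A -> A) (tri : A -> A -> A -> A) (alpha : A -> A).

(* The cyclic permutations of (x, y, z) are the identity,
   (x, y, z) |-> (y, z, x) and (x, y, z) |-> (z, x, y). *)
Definition cyclic_sum (f : A -> A -> A -> A) (x y z : A) : A :=
  f x y z + f y z x + f z x y.

Definition bilinear_op mul : Prop := bilinear_for *:%R *:%R mul.

Definition trilinear_op tri : Prop :=
  [/\ forall y z, linear (fun x => tri x y z),
      forall x z, linear (fun y => tri x y z)
    & forall x y, linear (fun z => tri x y z)].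

Record is_hom_algebra mul alpha : Prop := IsHomAlgebra {
  hom_algebra_bilinear : bilinear_op mul;
  hom_algebra_linear : linear alpha
}.

Definition hom_multiplicative mul alpha : Prop :=
  forall x y, alpha (mul x y) = mul (alpha x) (alpha y).

Definition anticommutative mul : Prop :=
  forall x y, mul x y = - mul y x.

Definition hom_jacobian mul alpha : A -> A -> A -> A :=
  cyclic_sum (fun x y z => mul (mul x y) (alpha z)).

Record is_hom_malcev mul alpha : Prop := IsHomMalcev {
  hom_malcev_algebra : is_hom_algebra mul alpha;
  hom_malcev_anticomm : anticommutative mul;
  hom_malcev_identity : forall x y z,
    hom_jacobian mul alpha (alpha x) (alpha y) (mul x z)
    = mul (hom_jacobian mul alpha x y z) (alpha (alpha x))
}.

Record is_hom_lie_yamaguti mul tri alpha : Prop := IsHomLieYamaguti {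
  hom_ly_bilinear : bilinear_op mul;
  hom_ly_trilinear : trilinear_op tri;
  hom_ly_linear : linear alpha;
  hom_ly1 : forall x y, alpha (mul x y) = mul (alpha x) (alpha y);
  hom_ly2 : forall x y z,
    alpha (tri x y z) = tri (alpha x) (alpha y) (alpha z);
  hom_ly3 : forall x y, mul x y = - mul y x;
  hom_ly4 : forall x y z, tri x y z = - tri y x z;
  hom_ly5 : forall x y z,
    cyclic_sum (fun a b c => mul (mul a b) (alpha c) + tri a b c) x y z = 0;
  hom_ly6 : forall x y z u,
    cyclic_sum (fun a b c => tri (mul a b) (alpha c) (alpha u)) x y z = 0;
  hom_ly7 : forall x y u v,
    tri (alpha x) (alpha y) (mul u v)
    = mul (tri x y u) (alpha (alpha v)) + mul (alpha (alpha u)) (tri x y v);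
  hom_ly8 : forall x y u v w,
    tri (alpha (alpha x)) (alpha (alpha y)) (tri u v w)
    = tri (tri x y u) (alpha (alpha v)) (alpha (alpha w))
      + tri (alpha (alpha u)) (tri x y v) (alpha (alpha w))
      + tri (alpha (alpha u)) (alpha (alpha v)) (tri x y w)
}.

Definition hom_malcev_ternary mul alpha (x y z : A) : A :=
  mul (mul x y) (alpha z) - mul (mul y z) (alpha x) - mul (mul z x) (alpha y).

End HomAlgebras.

(* Main.v *)
(** The classical argument for Malcev algebras survives the twist because
    multiplicativity makes the powers of [alpha] match in every term.  Write
    [f (xy|zw) = J(alpha x, alpha y, z * w)] and
    [g (w; x, y, z) = J(x, y, z) * alpha^2 w].  The linearized Hom-Malcev
    identity relates the six values of [f] to each other modulo values of [g],
    while expanding the Jacobians in any anticommutative Hom-algebra expresses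
    a signed sum of all six through [g].  Solving (which divides by 2) gives
    [2 f (uv|xy) + f (xy|uv) = g (v; x, y, u) - g (u; x, y, v)], and since
    [{x, y, z} = 2 (x * y) * alpha z - J(x, y, z)] this is precisely (HLY7).
    (HLY6) is another consequence of the same relations, and (HLY8) follows by
    applying the twisted derivation rule (HLY7) to each monomial of
    [{u, v, w}]. *)
Require Import Defs.
From mathcomp Require Import all_boot all_algebra.

Set Implicit Arguments.
Unset Strict Implicit.
Unset Printing Implicit Defensive.

Import GRing.Theory.
Local Open Scope ring_scope.

(** * Deciding equalities in abelian groups by reflection *)

Inductive zexpr : Type :=
  | ZVar of nat | ZZero | ZAdd of zexpr & zexpr | ZOpp of zexpr
  | ZMuln of zexpr & nat.

Fixpoint zeval (V : zmodType) (env : seq V) (t : zexpr) : V :=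
  match t with
  | ZVar n => env`_n
  | ZZero => 0
  | ZAdd t1 t2 => zeval env t1 + zeval env t2
  | ZOpp t1 => - zeval env t1
  | ZMuln t1 n => zeval env t1 *+ n
  end.

Fixpoint zcoef (i : nat) (t : zexpr) : int :=
  match t with
  | ZVar n => (i == n)%:Z
  | ZZero => 0
  | ZAdd t1 t2 => zcoef i t1 + zcoef i t2
  | ZOpp t1 => - zcoef i t1
  | ZMuln t1 n => zcoef i t1 * n%:Z
  end.

Lemma zeval_coef (V : zmodType) (env : seq V) (t : zexpr) :
  zeval env t = \sum_(i < size env) env`_i *~ zcoef i t.
Proof.
elim: t => [n||t1 IH1 t2 IH2|t1 IH1|t1 IH1 n] /=.
(* An index beyond [env] evaluates to the default [0] and meets no index of the sum. *)
- have [ltn|len] := ltnP n (size env).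
    rewrite (bigD1 (Ordinal ltn)) //= eqxx mulr1z big1 ?addr0 // => i.
    by rewrite -val_eqE /= => /negbTE->; rewrite mulr0z.
  rewrite nth_default // big1 // => i _.
  by rewrite (ltn_eqF (leq_trans (ltn_ord i) len)) mulr0z.
- by rewrite big1 // => i _; rewrite mulr0z.
- by rewrite IH1 IH2 -big_split; apply: eq_bigr => i _; rewrite mulrzDr.
- by rewrite IH1 -sumrN; apply: eq_bigr => i _; rewrite mulrNz.
- by rewrite IH1 -sumrMnl; apply: eq_bigr => i _; rewrite pmulrn mulrzA.
Qed.

Lemma zeval_eq (V : zmodType) (env : seq V) (t1 t2 : zexpr) :
  all (fun i => zcoef i t1 == zcoef i t2) (iota 0 (size env)) ->
  zeval env t1 = zeval env t2.
Proof.
move=> /allP coef_eq; rewrite !zeval_coef; apply: eq_bigr => i _.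
by rewrite (eqP (coef_eq i _)) // mem_iota ltn_ord.
Qed.

Ltac zindex x env :=
  lazymatch env with
  | x :: _ => constr:(O)
  | _ :: ?env' => let n := zindex x env' in constr:(S n)
  end.

Ltac zatoms t env :=
  lazymatch t with
  | (?a + ?b)%R => let env1 := zatoms a env in zatoms b env1
  | (- ?a)%R => zatoms a env
  | (?a *+ _)%R => zatoms a env
  | 0%R => env
  | _ => match constr:(tt) with
         | _ => let n := zindex t env in env
         | _ => constr:(t :: env)
         end
  end.

Ltac zreify t env :=
  lazymatch t with
  | (?a + ?b)%R =>
      let a' := zreify a env in let b' := zreify b env in constr:(ZAdd a' b')
  | (- ?a)%R => let a' := zreify a env in constr:(ZOpp a')
  | (?a *+ ?n)%R => let a' := zreify a env in constr:(ZMuln a' n)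
  | 0%R => constr:(ZZero)
  | _ => let n := zindex t env in constr:(ZVar n)
  end.

(* Decides equalities that hold in every abelian group, by comparing the
   integer coefficients of the atoms. *)
Ltac abelian :=
  lazymatch goal with
  | |- @eq ?T ?a ?b =>
      let env0 := zatoms a (@nil T) in
      let env := zatoms b env0 in
      let a' := zreify a env in
      let b' := zreify b env in
      refine (@zeval_eq _ env a' b' _); vm_compute; reflexivity
  end.

(** Derives an equation from a known one; the second premise is left to [abelian]. *)
Lemma eq_from_sub (V : zmodType) (a b x y : V) :
  a = b -> x - y = a - b -> x = y.
Proof. by move=> ->; rewrite subrr => /subr0_eq. Qed.

(** Characteristic 0 enters through this division by 2. *)
Lemma lmod_mulr2n_inj (K : fieldType) (charK0 : [pchar K] =i pred0)
    (A : lmodType K) : injective (fun x : A => x *+ 2).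
Proof.
move=> x y /= /eqP; rewrite -subr_eq0 -mulrnBl -scaler_nat scaler_eq0 subr_eq0.
by rewrite (pcharf0P K).1 // => /eqP.
Qed.

Lemma linear_add (K : pzRingType) (U V : lmodType K) (f : U -> V) :
  linear f -> {morph f : x y / x + y}.
Proof. by move=> lin_f x y; rewrite -[x in LHS]scale1r lin_f scale1r. Qed.

Lemma linear_opp (K : pzRingType) (U V : lmodType K) (f : U -> V) :
  linear f -> {morph f : x / - x}.
Proof.
move=> lin_f x; have f0 : f 0 = 0.
  by apply: (addrI (f 0)); rewrite -(linear_add lin_f) !addr0.
by apply/eqP; rewrite -addr_eq0 -(linear_add lin_f) addNr f0.
Qed.

Section HomMalcev.

Variables (K : fieldType) (charK0 : [pchar K] =i pred0) (A : lmodType K).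
Variables (mul : A -> A -> A) (alpha : A -> A).
Hypothesis malcevA : is_hom_malcev mul alpha.
Hypothesis alphaM : hom_multiplicative mul alpha.

Local Notation "x ∘ y" := (mul x y) (at level 40, left associativity).
Local Notation J := (hom_jacobian mul alpha).
Local Notation tri := (hom_malcev_ternary mul alpha).

Let mul_bilin : bilinear_op mul :=
  hom_algebra_bilinear (hom_malcev_algebra malcevA).
Let alpha_lin : linear alpha := hom_algebra_linear (hom_malcev_algebra malcevA).
Let mulC : anticommutative mul := hom_malcev_anticomm malcevA.

Let mul_linl z : linear (mul^~ z). Proof. exact: mul_bilin.1. Qed.
Let mul_linr z : linear (mul z). Proof. exact: mul_bilin.2. Qed.

Let mulDl z : {morph mul^~ z : x y / x + y}.
Proof. exact: linear_add (mul_linl z). Qed.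
Let mulDr z : {morph mul z : x y / x + y}.
Proof. exact: linear_add (mul_linr z). Qed.
Let mulNl z : {morph mul^~ z : x / - x}.
Proof. exact: linear_opp (mul_linl z). Qed.
Let mulNr z : {morph mul z : x / - x}.
Proof. exact: linear_opp (mul_linr z). Qed.
Let alphaD : {morph alpha : x y / x + y}.
Proof. exact: linear_add alpha_lin. Qed.
Let alphaN : {morph alpha : x / - x}.
Proof. exact: linear_opp alpha_lin. Qed.

Let expandE := (mulDl, mulDr, mulNl, mulNr, alphaD, alphaN, alphaM).

(** * The Hom-Jacobian and the relations between [f] and [g] *)

Lemma hom_jacobian_cycle x y z : J x y z = J y z x.
Proof. by rewrite /hom_jacobian /cyclic_sum; abelian. Qed.

Lemma hom_jacobian_swap x y z : J x y z = - J y x z.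
Proof.
rewrite /hom_jacobian /cyclic_sum (mulC y x) (mulC x z) (mulC z y) !mulNl.
by abelian.
Qed.

Definition jac_prod (x y z w : A) : A := J (alpha x) (alpha y) (z ∘ w).
Definition prod_jac (w x y z : A) : A := J x y z ∘ alpha (alpha w).
Local Notation f := jac_prod.
Local Notation g := prod_jac.

Lemma jac_prodCl x y z w : f x y z w = - f y x z w.
Proof. exact: hom_jacobian_swap. Qed.

Lemma jac_prodCr x y z w : f x y z w = - f x y w z.
Proof.
rewrite /f (mulC z w) /hom_jacobian /cyclic_sum !expandE.
by abelian.
Qed.

Lemma prod_jac_cycle w x y z : g w x y z = g w y z x.
Proof. by rewrite /g hom_jacobian_cycle. Qed.

Lemma prod_jac_swap w x y z : g w x y z = - g w y x z.
Proof. by rewrite /g hom_jacobian_swap mulNl. Qed.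

Lemma prod_jac_swapr w x y z : g w x y z = - g w x z y.
Proof. by rewrite prod_jac_cycle prod_jac_swap -prod_jac_cycle. Qed.

(** Polarization of the Hom-Malcev identity, quadratic in its first variable: its instances at [w]
    and [x] are subtracted from the one at [w + x]. *)
Lemma hom_malcev_linearized w x y z :
  f w y x z + f x y w z = g w x y z + g x w y z.
Proof.
have identity t := hom_malcev_identity malcevA t y z.
apply: (eq_from_sub (identity (w + x))).
have -> : f w y x z + f x y w z = J (alpha (w + x)) (alpha y) ((w + x) ∘ z)
    - J (alpha w) (alpha y) (w ∘ z) - J (alpha x) (alpha y) (x ∘ z).
  by rewrite /f /hom_jacobian /cyclic_sum !expandE; abelian.
rewrite !identity /g /hom_jacobian /cyclic_sum !expandE; abelian.
Qed.

Lemma jac_prod_sum x y z u :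
  f x y z u + f z u x y + f y z x u + f x u y z + f z x y u + f y u z x
  = g u x y z - g z x y u + g y x z u - g x y z u.
Proof.
have inner a b c d : alpha a ∘ (b ∘ c) ∘ d = - (b ∘ c ∘ alpha a ∘ d).
  by rewrite (mulC (alpha a)) mulNl.
have outer a b c d : alpha a ∘ alpha b ∘ (alpha c ∘ alpha d)
    = - (alpha c ∘ alpha d ∘ (alpha a ∘ alpha b)) by apply: mulC.
rewrite /f /g /hom_jacobian /cyclic_sum !expandE !inner.
(* Products of two products now cancel between [f x y z u] and [f z u x y], and likewise in the
   other two pairs; the remaining monomials are those of [g]. *)
rewrite (outer z u x y) (outer x u y z) (outer y u z x).
rewrite (mulC u x) (mulC u y) (mulC x z) !expandE.
abelian.
Qed.

(** Two linearized identities share [f y z x u] up to sign; their difference eliminates it. *)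
Lemma jac_prod_flip x y z u :
  f x y z u = f z u x y - g x y z u + g y x z u + g z x y u - g u x y z.
Proof.
have rel1 := hom_malcev_linearized x z y u.
have rel2 := hom_malcev_linearized y u z x.
apply: (eq_from_sub (congr2 (fun a b => a - b) rel1 rel2)).
rewrite (jac_prodCl z y x u) (jac_prodCr y z u x) (jac_prodCl u z y x).
rewrite (jac_prodCr z u y x) (prod_jac_swap x z y u).
rewrite (prod_jac_cycle y u z x) (prod_jac_swap y z x u).
rewrite (prod_jac_cycle u y z x) (prod_jac_cycle u z x y).
abelian.
Qed.

(** With [jac_prod_flip] and [jac_prod_rot2], this reduces all six values of [f] to [f z u x y]
    modulo [g]. *)
Lemma jac_prod_rot x y z u :
  f y z x u = f z u x y + g y x z u - g u x y z.
Proof.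
apply: (eq_from_sub (esym (hom_malcev_linearized y u z x))).
rewrite (jac_prodCr y z u x) (jac_prodCl u z y x) (jac_prodCr z u y x).
rewrite (prod_jac_cycle y u z x) (prod_jac_swap y z x u).
rewrite (prod_jac_cycle u y z x) (prod_jac_cycle u z x y).
abelian.
Qed.

Lemma jac_prod_rot2 x y z u :
  f y u z x = f z u x y + g y x z u + g z x y u.
Proof.
apply: (eq_from_sub (hom_malcev_linearized y z u x)).
rewrite (jac_prodCr z u y x) -(prod_jac_cycle y x z u) -(prod_jac_cycle z x y u).
abelian.
Qed.

Lemma jac_prod_balance x y z u :
  f z u x y *+ 2 + f x y z u = g u x y z - g z x y u.
Proof.
(* Modulo [g], the six-term sum is six times [f z u x y] and the left side of the claim three times,
   hence the doubling. *)
apply: (lmod_mulr2n_inj charK0); apply: (eq_from_sub (jac_prod_sum x y z u)).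
rewrite (jac_prod_flip x u y z) (jac_prod_flip z x y u) (jac_prod_flip x y z u).
rewrite (jac_prod_rot x y z u) (jac_prod_rot2 x y z u).
rewrite (prod_jac_cycle x u y z) (prod_jac_swapr y x u z).
rewrite (prod_jac_swapr z x u y) (prod_jac_swap x z y u).
rewrite (prod_jac_swap y z x u) (prod_jac_cycle u z x y).
abelian.
Qed.

(** Reduced to [f z u x y], this is [jac_prod_balance] again, in the form suited to (HLY6). *)
Lemma prod_jac_cyclic x y z u :
  g u x y z *+ 2 = f z u x y + f x u y z + f y u z x.
Proof.
apply/esym/(eq_from_sub (jac_prod_balance x y z u)).
rewrite (jac_prod_flip x u y z) (jac_prod_flip x y z u).
rewrite (jac_prod_rot x y z u) (jac_prod_rot2 x y z u).
rewrite (prod_jac_cycle x u y z) (prod_jac_swapr y x u z).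
rewrite (prod_jac_swapr z x u y).
abelian.
Qed.

(** * The axioms for the ternary operation *)

Lemma ternaryE x y z : tri x y z = (x ∘ y ∘ alpha z) *+ 2 - J x y z.
Proof.
rewrite /hom_malcev_ternary /hom_jacobian /cyclic_sum; abelian.
Qed.

Lemma ternary_trilinear : trilinear_op tri.
Proof.
split=> [y z | x z | x y] a p q;
  rewrite /hom_malcev_ternary !(alpha_lin, mul_linl, mul_linr) !scalerBr;
  abelian.
Qed.

Lemma ternary_alpha x y z :
  alpha (tri x y z) = tri (alpha x) (alpha y) (alpha z).
Proof. by rewrite /hom_malcev_ternary !expandE. Qed.

Lemma ternary_swap x y z : tri x y z = - tri y x z.
Proof.
rewrite /hom_malcev_ternary (mulC y x) (mulC x z) (mulC z y) !mulNl.
abelian.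
Qed.

Lemma ternary_jacobian x y z :
  cyclic_sum (fun a b c => a ∘ b ∘ alpha c + tri a b c) x y z = 0.
Proof. by rewrite /cyclic_sum /hom_malcev_ternary; abelian. Qed.

Lemma ternary_mul_cyclic x y z u :
  cyclic_sum (fun a b c => tri (a ∘ b) (alpha c) (alpha u)) x y z = 0.
Proof.
have triE a b c : tri (a ∘ b) (alpha c) (alpha u)
    = (a ∘ b ∘ alpha c ∘ alpha (alpha u)) *+ 2 - f c u a b.
  by rewrite ternaryE hom_jacobian_cycle.
(* Over the cycle, the doubled monomials of [triE] add up to [g u x y z *+ 2]. *)
apply: (eq_from_sub (prod_jac_cyclic x y z u)).
rewrite /cyclic_sum !triE /g /hom_jacobian /cyclic_sum !mulDl.
abelian.
Qed.

Lemma ternary_derivation x y u v :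
  tri (alpha x) (alpha y) (u ∘ v)
  = tri x y u ∘ alpha (alpha v) + alpha (alpha u) ∘ tri x y v.
Proof.
(* Twice this expansion accounts for all doubled products that [ternaryE] produces in the goal. *)
have fE : f u v x y = x ∘ y ∘ alpha u ∘ alpha (alpha v)
    - x ∘ y ∘ alpha v ∘ alpha (alpha u) - alpha (x ∘ y) ∘ alpha (u ∘ v).
  rewrite /f /hom_jacobian /cyclic_sum !alphaM (mulC (alpha v)) !mulNl.
  by rewrite (mulC (alpha u ∘ _)); abelian.
apply: (eq_from_sub (esym (jac_prod_balance x y u v))).
rewrite (mulC (alpha (alpha u))) !ternaryE fE -alphaM !mulr2n !mulDl !mulNl.
rewrite /f /g.
abelian.
Qed.

Lemma ternary_ternary x y u v w :
  tri (alpha (alpha x)) (alpha (alpha y)) (tri u v w)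
  = tri (tri x y u) (alpha (alpha v)) (alpha (alpha w))
    + tri (alpha (alpha u)) (tri x y v) (alpha (alpha w))
    + tri (alpha (alpha u)) (alpha (alpha v)) (tri x y w).
Proof.
have [_ _ /(_ (alpha (alpha x)) (alpha (alpha y))) lin3] := ternary_trilinear.
rewrite [tri u v w]/hom_malcev_ternary !(linear_add lin3) !(linear_opp lin3).
(* Each monomial of [tri u v w] is differentiated twice; the inner brackets become images under
   [alpha] of [tri x y u], [tri x y v] and [tri x y w], which are then made opaque so that only
   outer brackets unfold. *)
rewrite !ternary_derivation -!ternary_alpha.
move: (tri x y u) (tri x y v) (tri x y w) => p q r.
rewrite /hom_malcev_ternary !expandE.
abelian.
Qed.

End HomMalcev.

Theorem theorem1p2 (K : fieldType) (charK0 : [pchar K] =i pred0)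
    (A : lmodType K) (mul : A -> A -> A) (alpha : A -> A)
    (malcevA : is_hom_malcev mul alpha)
    (multA : hom_multiplicative mul alpha) :
  is_hom_lie_yamaguti mul (hom_malcev_ternary mul alpha) alpha.
Proof.
split.
- exact: hom_algebra_bilinear (hom_malcev_algebra malcevA).
- exact: ternary_trilinear.
- exact: hom_algebra_linear (hom_malcev_algebra malcevA).
- exact: multA.
- exact: ternary_alpha.
- exact: hom_malcev_anticomm malcevA.
- exact: ternary_swap.
- exact: ternary_jacobian.
- exact: ternary_mul_cyclic.
- exact: ternary_derivation.
- exact: ternary_ternary.
Qed.
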